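(* Let $(V,\Omega)$ be a symplectic vector space with canonical Liouville form $\theta$, given by $\theta_z(v_z)=\frac12\Omega(z,v)$ for $z,v\in V$. For $a\in V$ let $\psi^a(z)=\frac14\Omega(a,z)^2$ and $\theta^a=\theta+{\rm d}\psi^a$. Then for all $a,b\in V$, $${\rm Iso}(V^a,V^b)=\{\gamma\in{\rm Sp}(V,\Omega):\gamma(a)=b\ \text{or}\ \gamma(a)=-b\},$$ where ${\rm Iso}(V^a,V^b)$ is the set of all smooth maps $g:V\to V$ such that $g^*\theta^b=\theta^a$.
   Context: A symplectic vector space $(V,\Omega)$ is a finite-dimensional real vector space $V$ with a nonsingular alternating bilinear form $\Omega$. Regard $V$ as a smooth manifold; for $z,v\in V$ let $v_z\in T_zV$ be the tangent vector given by $v_z\psi=\frac{\rm d}{{\rm d}t}\psi(z+tv)|_{t=0}$ for smooth $\psi:V\to\mathbb{R}$. ${\rm Sp}(V,\Omega)$ is the group of linear automorphisms $g$ of $V$ with $\Omega(gx,gy)=\Omega(x,y)$ for all $x,y\in V$. *)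

(* Defs.v *)
From mathcomp Require Import all_boot all_order all_algebra.
From mathcomp Require Import all_classical all_reals all_analysis.
Import Order.TTheory GRing.Theory Num.Theory.
Import numFieldNormedType.Exports.
Import VectorInternalTheory.

Set Implicit Arguments.
Unset Strict Implicit.
Unset Printing Implicit Defensive.

Local Open Scope classical_set_scope.
Local Open Scope ring_scope.

(** A [vectType] carries no topology; its smooth structure is the one given by
    the global chart [v2r : V -> 'rV_(dim V)], a linear isomorphism with
    inverse [r2v]. *)
Section Smooth.
Context {R : realType}.

(** In finite dimension, [f] is C^(k+1) iff it is differentiable and all its
    directional derivatives [x |-> 'D_v f x] are C^k. *)
Fixpoint class_C (k : nat) (U W : normedModType R) (f : U -> W) : Prop :=
  match k with
  | 0 => continuous f
  | k'.+1 => (forall x, differentiable f x) /\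
             (forall v, class_C k' (fun x => 'D_v f x))
  end.

Definition in_coords (V W : vectType R) (g : V -> W) :
    'rV[R]_(dim V) -> 'rV[R]_(dim W) :=
  fun x => v2r (g (r2v x)).

Definition smooth (V W : vectType R) (g : V -> W) : Prop :=
  forall k, class_C k (in_coords g).

(** With [T_z V] identified with [V] by [v_z <-> v], the tangent map of [g] at
    [z] sends [v_z] to [(tangent_map g z v)_(g z)]. *)
Definition tangent_map (V W : vectType R) (g : V -> W) (z v : V) : W :=
  r2v ('d (in_coords g) (v2r z) (v2r v)).

End Smooth.

Section Forms.
Context {R : realType}.

(** [tangent z v psi] is [v_z psi]. *)
Definition tangent (V : vectType R) (z v : V) (psi : V -> R) : R :=
  derive1 (fun t : R => psi (z + t *: v)) 0.

(** A 1-form [eta] on [V] is encoded as [fun z v => eta_z (v_z)]. *)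
Definition ext_d (V : vectType R) (psi : V -> R) : V -> V -> R :=
  fun z v => tangent z v psi.

Definition pullback (V W : vectType R) (g : V -> W) (eta : W -> W -> R) :
    V -> V -> R :=
  fun z v => eta (g z) (tangent_map g z v).

End Forms.

Section Symplectic.
Context {R : realType} {V : vectType R}.

Definition alternating_form (Omega : V -> V -> R) : Prop :=
  forall x, Omega x x = 0.

Definition nonsingular_form (Omega : V -> V -> R) : Prop :=
  forall x, (forall y, Omega x y = 0) -> x = 0.

Definition Sp (Omega : V -> V -> R) : set (V -> V) :=
  [set g | [/\ linear g, bijective g &
               forall x y, Omega (g x) (g y) = Omega x y]].

Definition liouville (Omega : V -> V -> R) : V -> V -> R :=
  fun z v => 2^-1 * Omega z v.

Definition psi_ (Omega : V -> V -> R) (a : V) : V -> R :=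
  fun z => 4^-1 * Omega a z ^+ 2.

Definition theta_ (Omega : V -> V -> R) (a : V) : V -> V -> R :=
  fun z v => liouville Omega z v + ext_d (psi_ Omega a) z v.

(** [Iso Omega a b] is Iso(V^a, V^b), where V^a is [V] with [theta_ Omega a]. *)
Definition Iso (Omega : V -> V -> R) (a b : V) : set (V -> V) :=
  [set g | smooth g /\ pullback g (theta_ Omega b) = theta_ Omega a].

End Symplectic.

(* Main.v *)
From HB Require Import structures.
Require Import Defs.
From mathcomp Require Import all_boot all_order all_algebra.
From mathcomp Require Import all_classical all_reals all_analysis.
From mathcomp Require Import ring lra.
Import Order.TTheory GRing.Theory Num.Theory.
Import numFieldNormedType.Exports.
Import VectorInternalTheory.

Set Implicit Arguments.
Unset Strict Implicit.
Unset Printing Implicit Defensive.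

Local Open Scope classical_set_scope.
Local Open Scope ring_scope.

(** Put [A_a z = z + Omega(a, z) a].  Since
    [theta^a_z(v) = Omega(A_a z, v) / 2], the linear vector field [A_a] is, up
    to the factor 2, the dual of [theta^a] with respect to [Omega], which is the
    exterior derivative of [theta^a] for every [a].  A smooth [g] with
    [g^* theta^b = theta^a] therefore preserves the symplectic form
    ([jacobian_symplectic]; this is where the equality of mixed second
    derivatives, [derive_comm_mx], enters), and so it relates the two fields:
    [A_b (g z) = Dg_z (A_a z)] ([vector_fields_related]).

    The operator [A_a] is the identity plus an endomorphism [N_a] of square
    zero, so the flow of the field is [z |-> e^t (z + t N_a z)]: every
    trajectory tends to the origin as [t] tends to minus infinity, at the speed
    [e^t] up to a factor that is polynomial in [t].  The flows are intertwined
    by [g] and also by its linear part [L] at the origin.  Hence the error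
    [g z - L z] is the image under the expanding flow, at time [t], of the error
    at a point [w] of norm [O(t e^(-t))].  The error at [w] is quadratic in [w]
    ([remainder_quadratic]), whereas the expanding flow has norm [O(t e^t)]; so
    [g z - L z], a constant, is [O(t^3 e^(-t))] as [t] tends to infinity, and
    [g = L] ([related_map_linear]).  Finally [L A_a = A_b L] with [L] symplectic says
    that the rank one forms [w |-> Omega(b, w) b] and [w |-> Omega(L a, w) L a]
    agree, i.e. that [b] is [L a] or [- L a] ([related_map_parameter]).

    Conversely a linear symplectic map with [gamma a = b] or [gamma a = - b]
    preserves the formula for [theta], which is quadratic in [a]
    ([Sp_sub_Iso]).

    The forward direction is carried out on row vectors.  [S] is the matrix of
    [Omega], endomorphisms act by right multiplication, [N a] and [P a] are the
    matrices of [N_a] and [A_a], and [J z] is that of [Dg_z]. *)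

(** * Derivatives of vector- and matrix-valued maps *)

Section Calculus.
Context {R : realType}.

Lemma is_derive_line (V W : normedModType R) (f : V -> W) (x u : V) (s : R) :
  derivable f (x + s *: u) u ->
  is_derive s (1 : R) (fun s' => f (x + s' *: u)) ('D_u f (x + s *: u)).
Proof.
have e : (fun h : R => h^-1 *: (f (x + (h *: (1 : R) + s) *: u) - f (x + s *: u)))
       = (fun h => h^-1 *: (f (h *: u + (x + s *: u)) - f (x + s *: u))).
  apply/funext => h; congr (_ *: (f _ - _)).
  by rewrite [h *: 1]mulr1 scalerDl addrCA.
by move=> df; split; rewrite /derivable /derive /= e.
Qed.

(** The mean value theorem applied twice: first to
    [s |-> f (z + h v + s u) - f (z + s u)], then to [t |-> 'D_u f (z + s u + t v)]. *)
Lemma second_difference_mean_value (V : normedModType R) (f : V -> R)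
    (u v z : V) (h : R) :
  (forall x, derivable f x u) -> (forall x, derivable ('D_u f) x v) -> 0 < h ->
  exists s t, [/\ 0 < s < h, 0 < t < h &
    f (z + h *: u + h *: v) - f (z + h *: u) - f (z + h *: v) + f z
      = 'D_v ('D_u f) (z + s *: u + t *: v) * h ^+ 2].
Proof.
move=> fu fuv h0.
pose phi s := f (z + h *: v + s *: u) - f (z + s *: u).
pose dphi s := 'D_u f (z + h *: v + s *: u) - 'D_u f (z + s *: u).
have Dphi (s : R) : is_derive s (1 : R) phi (dphi s).
  by apply: is_deriveB; exact: is_derive_line.
have cphi : {within `[0, h], continuous phi}.
  by apply: derivable_within_continuous => x _; have [] := Dphi x.
have [s s_in phiE] := MVT h0 (fun s _ => Dphi s) cphi.
pose chi t := 'D_u f (z + s *: u + t *: v).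
have Dchi (t : R) : is_derive t (1 : R) chi ('D_v ('D_u f) (z + s *: u + t *: v)).
  exact: is_derive_line.
have cchi : {within `[0, h], continuous chi}.
  by apply: derivable_within_continuous => x _; have [] := Dchi x.
have [t t_in chiE] := MVT h0 (fun t _ => Dchi t) cchi.
exists s, t; split; [by rewrite in_itv in s_in|by rewrite in_itv in t_in|].
move: phiE chiE; rewrite /phi /dphi /chi !scale0r !addr0 !subr0.
rewrite ![_ + h *: v + _]addrAC => phiE chiE.
rewrite -[LHS]/(_ - _ - _ + _) expr2 mulrA -chiE -phiE; ring.
Qed.

(** The second difference of [f] along [u] and [v] is symmetric in the two
    directions, and [second_difference_mean_value] expresses it through either
    mixed derivative at a point arbitrarily close to [z]. *)
Lemma derive_comm (V : normedModType R) (f : V -> R) (u v z : V) :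
  (forall x, derivable f x u) -> (forall x, derivable f x v) ->
  (forall x, derivable ('D_u f) x v) -> (forall x, derivable ('D_v f) x u) ->
  {for z, continuous ('D_v ('D_u f))} -> {for z, continuous ('D_u ('D_v f))} ->
  'D_v ('D_u f) z = 'D_u ('D_v f) z.
Proof.
move=> fu fv fuv fvu cvu cuv; apply/eqP; rewrite -subr_eq0 -normr_le0.
apply/ler_addgt0Pr => e e0; rewrite add0r.
have e20 : 0 < e / 2 by rewrite divr_gt0.
have /cvgrPdist_lt/(_ _ e20)/nbhs_normP[d1 /= d10 c1] := cvu.
have /cvgrPdist_lt/(_ _ e20)/nbhs_normP[d2 /= d20 c2] := cuv.
(* Scaling the step by this bound keeps the intermediate points in both balls. *)
pose M := 1 + `|u| + `|v|.
have M0 : 0 < M by rewrite /M -addrA ltr_pwDl// addr_ge0.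
pose h := Num.min d1 d2 / M.
have h0 : 0 < h by rewrite divr_gt0// lt_min d10.
have near_z s t w w' : `|w| + `|w'| < M -> 0 < s < h -> 0 < t < h ->
    `|z - (z + s *: w + t *: w')| < Num.min d1 d2.
  move=> wM /andP[s0 sh] /andP[t0 th].
  rewrite -addrA opprD addNKr normrN (le_lt_trans (ler_normD _ _))//.
  rewrite !normrZ !gtr0_norm//.
  rewrite (@le_lt_trans _ _ (h * (`|w| + `|w'|)))//.
    by rewrite mulrDr lerD// ler_wpM2r// ltW.
  by rewrite -[ltRHS](divfK (lt0r_neq0 M0)) ltr_pM2l.
have uvM : `|u| + `|v| < M by rewrite /M -addrA ltrDr.
have [s [t [s_in t_in E]]] :=
  @second_difference_mean_value _ f u v z h fu fuv h0.
have [s' [t' [s'_in t'_in E']]] :=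
  @second_difference_mean_value _ f v u z h fv fvu h0.
have EE : 'D_v ('D_u f) (z + s *: u + t *: v)
        = 'D_u ('D_v f) (z + s' *: v + t' *: u).
  have h20 := lt0r_neq0 (exprn_gt0 2 h0).
  rewrite [z + h *: v + _]addrAC in E'.
  by apply: (mulIf h20); rewrite -E -E'; congr (_ + _); exact: addrAC.
have := near_z _ _ _ _ uvM s_in t_in; rewrite lt_min => /andP[/c1/= B1 _].
have vuM : `|v| + `|u| < M by rewrite addrC.
have := near_z _ _ _ _ vuM s'_in t'_in; rewrite lt_min => /andP[_ /c2/= B2].
rewrite EE in B1.
rewrite -(subrKA ('D_u ('D_v f) (z + s' *: v + t' *: u))).
apply: le_trans (ler_normD _ _) _; rewrite [leRHS]splitr.
by apply: lerD; apply: ltW; [exact: B1|rewrite distrC; exact: B2].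
Qed.

Lemma is_derive_mxP (V : normedModType R) m n (M : V -> 'M[R]_(m, n))
    (x v : V) (dM : 'M[R]_(m, n)) :
  is_derive x v M dM <->
  forall i j, is_derive x v (fun y => M y i j) (dM i j).
Proof.
split=> [[Md <-] i j|H].
  by split; [exact: (derivable_mxP _ _ _).1|rewrite derive_mx// mxE].
have Md : derivable M x v by apply/derivable_mxP => i j; have [] := H i j.
split=> //; rewrite derive_mx//; apply/matrixP => i j; rewrite mxE.
by have [] := H i j.
Qed.

Lemma is_derive_mulmx (V : normedModType R) m n p (A : V -> 'M[R]_(m, n))
    (B : V -> 'M[R]_(n, p)) (x v : V) dA dB :
  is_derive x v A dA -> is_derive x v B dB ->
  is_derive x v (fun y => A y *m B y) (A x *m dB + dA *m B x).
Proof.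
move=> /is_derive_mxP Ad /is_derive_mxP Bd; apply/is_derive_mxP => i j.
have -> : (fun y => (A y *m B y) i j) =
    \sum_k ((fun y => A y i k) * (fun y => B y k j)).
  by apply/funext => y; rewrite mxE fct_sumE.
apply: is_derive_eq.
rewrite !mxE -big_split/=; apply: eq_bigr => k _.
by rewrite [dA i k * _]mulrC.
Qed.

Lemma is_derive_trmx (V : normedModType R) m n (A : V -> 'M[R]_(m, n))
    (x v : V) dA :
  is_derive x v A dA -> is_derive x v (fun y => (A y)^T) dA^T.
Proof.
move=> /is_derive_mxP Ad; apply/is_derive_mxP => i j; rewrite mxE.
by under eq_fun do rewrite mxE.
Qed.

Lemma is_derive_comp (V W : normedModType R) (g : V -> W) (c : R -> V) t dc :
  is_derive t (1 : R) c dc -> differentiable g (c t) ->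
  is_derive t (1 : R) (g \o c) ('d g (c t) dc).
Proof.
move=> [cd <-] gd.
have cdiff : differentiable c t by apply/derivable1_diffP.
have gcdiff : differentiable (g \o c) t by exact: differentiable_comp.
split; first exact: diff_derivable.
by rewrite !deriveE// diff_comp.
Qed.

Lemma differentiable_lipschitz_at (V W : normedModType R) (f : V -> W) x :
  differentiable f x ->
  exists2 C, 0 < C & \forall w \near 0, `|f (w + x) - f x| <= C * `|w|.
Proof.
move=> fd; have [k k0 dk] := linear_lipschitz (diff_continuous fd).
exists (k + 1); first by rewrite addr_gt0.
have /eqaddoP/(_ 1 ltr01) := diff_locally fd.
apply: filterS => w; rewrite /= mul1r => wo.
pose e := f (w + x) - (f x + 'd f x w).
have -> : f (w + x) - f x = 'd f x w + e.
  by rewrite /e addrCA opprD ['d f x w + _]addrCA subrr addr0.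
rewrite (le_trans (ler_normD _ _))// mulrDl mul1r lerD//.
Qed.

Lemma normr_mx_entry m n (A : 'M[R]_(m, n)) i j : `|A i j| <= `|A|.
Proof.
rewrite [leRHS]/Num.Def.normr/= mx_normrE.
exact: (le_bigmax _ (fun ij : 'I_m * 'I_n => `|A ij.1 ij.2|) (i, j)).
Qed.

Lemma normr_mulmx m n p (A : 'M[R]_(m, n)) (B : 'M[R]_(n, p)) :
  `|A *m B| <= n%:R * `|A| * `|B|.
Proof.
have C0 : 0 <= n%:R * `|A| * `|B| by rewrite !mulr_ge0.
rewrite [leLHS]/Num.Def.normr/= mx_normrE; apply: bigmax_le => //= -[i j] _ /=.
rewrite mxE (le_trans (ler_norm_sum _ _ _))//.
rewrite -mulrA mulr_natl -[X in _ *+ X]card_ord -sumr_const ler_sum// => k _.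
by rewrite normrM ler_pM// normr_mx_entry.
Qed.

Lemma mulmxr_continuous m n p (B : 'M[R]_(n, p)) :
  continuous (mulmxr B : 'M[R]_(m, n) -> 'M[R]_(m, p)).
Proof.
apply/bounded_linear_continuous/linear_boundedP; near=> r => A /=.
rewrite (le_trans (normr_mulmx _ _))// mulrAC ler_wpM2r//.
Unshelve. all: by end_near. Qed.

Lemma is_derive_mulmxr (V : normedModType R) m n p (A : V -> 'M[R]_(m, n))
    (B : 'M[R]_(n, p)) (x v : V) dA :
  is_derive x v A dA -> is_derive x v (fun y => A y *m B) (dA *m B).
Proof.
move=> Ad; have := is_derive_mulmx Ad (is_derive_cst B x v).
by rewrite mulmx0 add0r.
Qed.

Lemma derive_mx_entry (V : normedModType R) m n (f : V -> 'M[R]_(m, n)) v x i j :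
  derivable f x v -> 'D_v f x i j = 'D_v (fun y => f y i j) x.
Proof. by move=> fd; rewrite derive_mx// mxE. Qed.

Lemma derive_comm_mx (V : normedModType R) m n (f : V -> 'M[R]_(m, n)) :
  class_C 2 f -> forall u v x, 'D_u ('D_v f) x = 'D_v ('D_u f) x.
Proof.
move=> [f1 f2] u v x; apply/matrixP => i j.
have fd y w : derivable f y w by exact: diff_derivable.
have f2d w y w' : derivable ('D_w f) y w'.
  by apply: diff_derivable; have [] := f2 w.
pose fij y := f y i j.
have fijE w : 'D_w fij = fun y => 'D_w f y i j.
  by apply/funext => y; rewrite derive_mx_entry.
have fij2E w w' y : 'D_w ('D_w' fij) y = 'D_w ('D_w' f) y i j.
  by rewrite fijE -derive_mx_entry.
have fij2_cont w w' : {for x, continuous ('D_w ('D_w' fij))}.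
  rewrite (funext (fij2E w w')).
  apply: (@continuous_comp V 'M[R]_(m, n) R _ (fun A => A i j)).
    by have [_ /(_ w)/(_ x)] := f2 w'.
  exact: coord_continuous.
transitivity ('D_u ('D_v fij) x); first by rewrite fij2E.
transitivity ('D_v ('D_u fij) x); last by rewrite fij2E.
have fij_d w y : derivable fij y w by exact: (derivable_mxP _ _ _).1.
have fij_dd w w' y : derivable ('D_w fij) y w'.
  by rewrite fijE; exact: (derivable_mxP _ _ _).1.
exact: derive_comm.
Qed.

Lemma is_derive_scalemx (V : normedModType R) m n (k : V -> R)
    (A : V -> 'M[R]_(m, n)) (x v : V) dk dA :
  is_derive x v k dk -> is_derive x v A dA ->
  is_derive x v (fun y => k y *: A y) (k x *: dA + dk *: A x).
Proof.
move=> kd /is_derive_mxP Ad; apply/is_derive_mxP => i j.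
have -> : (fun y => (k y *: A y) i j) = k * (fun y => A y i j).
  by apply/funext => y; rewrite mxE.
have := Ad i j => Aij; apply: is_derive_eq.
by rewrite !mxE [dk * _]mulrC.
Qed.

Lemma is_derive_affine_mx m n (A B : 'M[R]_(m, n)) (t : R) :
  is_derive t (1 : R) (fun s => A + s *: B) B.
Proof.
apply/is_derive_mxP => i j.
have -> : (fun s : R => (A + s *: B) i j) =
    cst (A i j) + (fun s => B i j * s).
  by apply/funext => s; rewrite !mxE mulrC.
apply: is_derive_eq.
by rewrite add0r [_ *: _]mulr1.
Qed.

Lemma is_derive0_mx_const m n (h : R -> 'M[R]_(m, n)) (s t : R) :
  (forall x, is_derive x (1 : R) h 0) -> h s = h t.
Proof.
move=> hd; apply/matrixP => i j.
apply: (@is_derive_0_is_cst _ (fun x => h x i j)) => x.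
by have /is_derive_mxP/(_ i j) := hd x; rewrite mxE.
Qed.

(** Exponential decay beats a fourth power: [1 + t <= 4 (1 + t / 4)] and
    [1 + t / 4 <= expR (t / 4)]. *)
Lemma pow4_expRN_le (t : R) : 0 <= t ->
  (1 + t) ^+ 4 * expR (- t) <= 256.
Proof.
move=> t0; rewrite expRN ler_pdivrMr ?expR_gt0//.
have -> : expR t = expR (t / 4) ^+ 4 by rewrite -expRM_natl mulrCA divff ?mulr1.
have -> : 256 = 4 ^+ 4 :> R by rewrite -natrX.
rewrite -exprMn lerXn2r ?nnegrE ?mulr_ge0 ?expR_ge0 ?addr_ge0//.
have := expR_ge1Dx (t / 4); lra.
Qed.

End Calculus.

(** * Jacobians of twice differentiable maps *)

Section Jacobian.
Context {R : realType} {n : nat}.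
Variable G : 'rV[R]_n -> 'rV[R]_n.
Hypothesis G2 : class_C 2 G.

Let e (i : 'I_n) : 'rV[R]_n := delta_mx 0 i.

Lemma row_jacobian z i : row i (jacobian G z) = 'D_(e i) G z.
Proof. by have [G1 _] := G2; rewrite rowE deriveEjacobian. Qed.

Lemma is_derive_jacobian z v :
  is_derive z v (jacobian G) (\matrix_i 'D_v ('D_(e i) G) z).
Proof.
have [G1 GG] := G2; apply/is_derive_mxP => i j; rewrite mxE.
have -> : (fun y => jacobian G y i j) = (fun y => 'D_(e i) G y 0 j).
  by apply/funext => y; rewrite -row_jacobian [RHS]mxE.
have : is_derive z v ('D_(e i) G) ('D_v ('D_(e i) G) z).
  have [D_diff _] := GG (e i).
  by apply: derivableP; apply: diff_derivable; exact: D_diff.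
by move=> /is_derive_mxP.
Qed.

Lemma is_derive_vector_map z v : is_derive z v G (v *m jacobian G z).
Proof.
have [G1 _] := G2; rewrite -deriveEjacobian//.
by apply: derivableP; exact: diff_derivable.
Qed.

(** Each row of the Jacobian is a directional derivative of [G], hence
    differentiable at the origin. *)
Lemma jacobian_lipschitz : exists2 C, 0 < C &
  \forall w \near 0, forall v : 'rV[R]_n,
    `|v *m (jacobian G w - jacobian G 0)| <= C * `|v| * `|w|.
Proof.
have [G1 GG] := G2.
have /choice[C HC] (i : 'I_n) : exists C, 0 < C /\
    \forall w \near 0, `|'D_(e i) G w - 'D_(e i) G 0| <= C * `|w|.
  have [G3 _] := GG (e i).
  have [C C0 HC] := differentiable_lipschitz_at (G3 0).
  exists C; split; first exact: C0.
  by apply: filterS HC => w; rewrite addr0; exact.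
exists (1 + \sum_i C i).
  by rewrite ltr_pwDl// sumr_ge0// => i _; have [/ltW] := HC i.
have near_all : \forall w \near 0, forall i,
    `|'D_(e i) G w - 'D_(e i) G 0| <= C i * `|w|.
  apply: (@filter_forall _ _ (fun i (w : 'rV[R]_n) =>
    `|'D_(e i) G w - 'D_(e i) G 0| <= C i * `|w|) (nbhs (0 : 'rV[R]_n))) => i.
  by case: (HC i).
apply: filterS near_all => w Hw v.
rewrite mulmx_sum_row (le_trans (ler_norm_sum _ _ _))//.
rewrite -mulrA mulrDl mul1r mulr_suml -[leLHS]add0r.
rewrite lerD ?mulr_ge0// ler_sum// => i _.
have -> : row i (jacobian G w - jacobian G 0) = 'D_(e i) G w - 'D_(e i) G 0.
  by rewrite -2!row_jacobian; apply/rowP => k; rewrite !mxE.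
rewrite normrZ mulrCA.
by apply: ler_pM => //; exact: normr_mx_entry.
Qed.

End Jacobian.

(** * The linear vector field dual to the perturbed Liouville form *)

Section Transvection.
Context {R : realType} {n : nat}.
Variable S : 'M[R]_n.
Hypothesis S_skew : S^T = - S.

(** In row vectors, the endomorphism [N_a : z |-> Omega(a, z) a]. *)
Definition transvection_part (a : 'rV[R]_n) : 'M[R]_n := (a *m S)^T *m a.
Definition transvection (a : 'rV[R]_n) : 'M[R]_n := 1%:M + transvection_part a.

Local Notation N := transvection_part.
Local Notation P := transvection.

Lemma skew_mx_isotropic (x : 'rV[R]_n) : x *m S *m x^T = 0.
Proof.
have : (x *m S *m x^T)^T = - (x *m S *m x^T).
  by rewrite !trmx_mul trmxK S_skew mulNmx mulmxN mulmxA.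
move=> /matrixP/(_ 0 0); rewrite !mxE => h.
by apply/matrixP => i j; rewrite !ord1 [RHS]mxE mxE; lra.
Qed.

Lemma transvection_part_sqr a : N a *m N a = 0.
Proof.
rewrite /N mulmxA -(mulmxA _ a) trmx_mul S_skew mulNmx mulmxN.
by rewrite mulmxA skew_mx_isotropic oppr0 mulmx0 mul0mx.
Qed.

Lemma transvection_unit a : P a \in unitmx.
Proof.
suff /mulmx1_unit[] : P a *m (1%:M - N a) = 1%:M by [].
by rewrite mulmxDl mul1mx mulmxBr mulmx1 transvection_part_sqr subr0 subrK.
Qed.

(** The summand [N a *m S] is symmetric, being twice the Hessian matrix of
    [psi^a]: adding [d psi^a] does not change the exterior derivative. *)
Lemma transvection_skew_part a : P a *m S - (P a *m S)^T = 2 *: S.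
Proof.
rewrite /P /N mulmxDl mul1mx -mulmxA linearD/= S_skew.
rewrite [((_)^T *m _)^T]trmx_mul trmxK opprD opprK addrACA subrr addr0.
by rewrite scaler_nat mulr2n.
Qed.

End Transvection.

(** * Rigidity in coordinates *)

Section Rigidity.
Context {R : realType} {n : nat}.
Variables (S : 'M[R]_n) (a b : 'rV[R]_n) (G : 'rV[R]_n -> 'rV[R]_n).
Hypotheses (S_skew : S^T = - S) (S_unit : S \in unitmx) (G2 : class_C 2 G).

Local Notation N := (transvection_part S).
Local Notation P := (transvection S).
Local Notation J := (jacobian G).

(** The equality of 1-forms [G^* theta^b = theta^a] at [z], as an equality of
    row vectors of coefficients. *)
Hypothesis pullbackG : forall z, G z *m (P b *m S) *m (J z)^T = z *m (P a *m S).

(** Differentiating [pullbackG] gives [J P_b S J^T] plus a matrix [T] of second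
    derivatives of [G].  As [T] is symmetric, antisymmetrising removes it, and
    it turns [P_b S] and [P_a S] into [2 S]: this is [g^* d theta = d theta]. *)
Lemma jacobian_symplectic z : J z *m S *m (J z)^T = S.
Proof.
pose e (i : 'I_n) : 'rV[R]_n := delta_mx 0 i.
pose T : 'M[R]_n := \matrix_i
  (G z *m (P b *m S) *m (\matrix_j 'D_(e i) ('D_(e j) G) z)^T).
have T_sym : T^T = T.
  have TE i j : T i j =
      \sum_k (G z *m (P b *m S)) 0 k * 'D_(e i) ('D_(e j) G) z 0 k.
    rewrite /T mxE mxE; apply: eq_bigr => k _; congr (_ * _).
    by rewrite mxE mxE.
  apply/matrixP => i j; rewrite mxE TE TE.
  by apply: eq_bigr => k _; rewrite (derive_comm_mx G2).
have E : P a *m S = T + J z *m (P b *m S) *m (J z)^T.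
  apply/row_matrixP => i.
  have dL := is_derive_mulmx
    (is_derive_mulmxr (P b *m S) (is_derive_vector_map G2 z (e i)))
    (is_derive_trmx (is_derive_jacobian G2 z (e i))).
  have dR := is_derive_mulmxr (P a *m S) (is_derive_id z (e i)).
  have := @derive_val _ _ _ _ _ _ _ dL; under eq_fun do rewrite pullbackG.
  rewrite (@derive_val _ _ _ _ _ _ _ dR) => {}dL.
  by rewrite rowE dL linearD/= rowK rowE !mulmxA.
have := transvection_skew_part S_skew a; rewrite E linearD/= T_sym.
rewrite opprD addrACA subrr add0r !trmx_mul trmxK -trmx_mul mulmxA.
rewrite -mulmxBl -mulmxBr transvection_skew_part//.
rewrite -scalemxAr -scalemxAl; apply: scalerI.
by rewrite pnatr_eq0.
Qed.

Lemma jacobian_unit z : J z \in unitmx.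
Proof.
have := S_unit; rewrite -{1}(jacobian_symplectic z) !unitmx_mul.
by move=> /andP[/andP[]].
Qed.

(** The Jacobian being symplectic, [S J^T] can be cancelled in [pullbackG]. *)
Lemma vector_fields_related z : G z *m P b = z *m P a *m J z.
Proof.
have JT_unit : (J z)^T \in unitmx by rewrite unitmx_tr jacobian_unit.
have := pullbackG z.
rewrite -[X in _ = _ *m (_ *m X)](jacobian_symplectic z) !mulmxA.
by move=> /(can_inj (mulmxK JT_unit))/(can_inj (mulmxK S_unit)).
Qed.

Local Notation L := (J 0).

(** Derivative at the origin of [vector_fields_related]; the term with the
    derivative of [J] is multiplied by the point, here [0]. *)
Lemma linear_part_related : L *m P b = P a *m L.
Proof.
apply/row_matrixP => i; rewrite !rowE; set v := delta_mx 0 i.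
have dL := is_derive_mulmxr (P b) (is_derive_vector_map G2 0 v).
have dR := is_derive_mulmx
  (is_derive_mulmxr (P a) (is_derive_id 0 v)) (is_derive_jacobian G2 0 v).
have := @derive_val _ _ _ _ _ _ _ dL; under eq_fun do rewrite vector_fields_related.
by rewrite (@derive_val _ _ _ _ _ _ _ dR) !mul0mx add0r !mulmxA.
Qed.

Lemma linear_part_related_nilpotent : L *m N b = N a *m L.
Proof.
have := linear_part_related.
by rewrite /P mulmxDr mulmxDl mulmx1 mul1mx => /addrI.
Qed.

(** Relatedness at [w] and at the origin write the remainder without Taylor's
    formula: [(G w - w L) P_b = w P_a (J w - L)], where both factors on the right
    are [O(w)]. *)
Lemma remainder_quadratic : exists2 K, 0 <= K & exists2 d, 0 < d &
  forall w, `|w| < d -> `|G w - w *m L| <= K * `|w| ^+ 2.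
Proof.
have [C C0 /nbhs_norm0P[d /= d0 HC]] := jacobian_lipschitz G2.
exists (n%:R * (C * (n%:R * `|P a|)) * `|invmx (P b)|).
  by rewrite !mulr_ge0// ltW.
exists d => // w /HC/(_ (w *m P a)) HCw.
have -> : G w - w *m L = w *m P a *m (J w - L) *m invmx (P b).
  apply: (can_inj (mulmxK (transvection_unit S_skew b))).
  rewrite mulmxKV ?transvection_unit// mulmxBl mulmxBr.
  rewrite vector_fields_related.
  congr (_ - _); rewrite -(mulmxA w L).
  by rewrite linear_part_related mulmxA.
rewrite (le_trans (normr_mulmx _ _))// [leRHS]mulrAC ler_wpM2r//.
rewrite -[leRHS]mulrA ler_wpM2l// (le_trans HCw)// expr2 mulrA ler_wpM2r//.
by rewrite -[leRHS]mulrA ler_wpM2l ?(ltW C0)// [leRHS]mulrAC normr_mulmx.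
Qed.

(** The curve [c s = e^s z (1 + s N_a)] through [z] is a trajectory of [P_a], and
    transporting [G (c s)] back along the flow of [P_b] gives a curve [h] with
    derivative zero.  The equality [h 0 = h (- t)], and its counterpart for the
    linear map [L], give the identity. *)
Lemma flow_conjugation z t : let w := expR (- t) *: (z *m (1%:M - t *: N a)) in
  G z - z *m L = expR t *: ((G w - w *m L) *m (1%:M + t *: N b)).
Proof.
pose c s := expR s *: (z *m (1%:M + s *: N a)).
pose h s := expR (- s) *: (G (c s) *m (1%:M + s *: - N b)).
have c_derive s : is_derive s (1 : R) c (c s *m P a).
  have := is_derive_scalemx (is_derive_expR s)
    (is_derive_mulmx (is_derive_cst z s 1) (is_derive_affine_mx 1%:M (N a) s)).
  congr is_derive; rewrite mul0mx addr0 /c /P -scalemxAl -scalerDr.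
  congr (_ *: _); rewrite -mulmxA mulmxDr mulmx1 mulmxDl mul1mx -scalemxAl.
  by rewrite transvection_part_sqr// scaler0 addr0 -mulmxDr addrC.
have h_derive s : is_derive s (1 : R) h 0.
  have dexpN : is_derive s (1 : R) (fun s => expR (- s)) (- expR (- s)).
    by apply: is_derive_eq; rewrite mulrN1.
  have [G1 _] := G2.
  have dGc := is_derive_comp (c_derive s) (G1 _).
  have := is_derive_scalemx dexpN
    (is_derive_mulmx dGc (is_derive_affine_mx 1%:M (- N b) s)).
  congr is_derive; rewrite scaleNr -scalerBr.
  rewrite -deriveE// deriveEjacobian// -vector_fields_related.
  rewrite -mulmxA -mulmxDr -mulmxBr (_ : _ - _ = 0) ?mulmx0 ?scaler0//.
  rewrite /P mulmxDr mulmx1 !mulmxDl !mul1mx.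
  rewrite -scalemxAr mulmxN transvection_part_sqr// oppr0 scaler0 addr0.
  by rewrite [1%:M + N b + _]addrAC [- N b + _]addrC addrK subrr.
move=> w.
have w_c : w = c (- t) by rewrite /w /c scaleNr.
have Gz : G z = expR t *: (G w *m (1%:M + t *: N b)).
  have := is_derive0_mx_const 0 (- t) h_derive.
  rewrite /h -w_c /c !scale0r !addr0 !mulmx1 oppr0 expR0 !scale1r opprK.
  by rewrite scaleNr scalerN opprK.
have Lz : z *m L = expR t *: (w *m L *m (1%:M + t *: N b)).
  rewrite -mulmxA (_ : L *m _ = (1%:M + t *: N a) *m L); last first.
    rewrite mulmxDr mulmxDl mulmx1 mul1mx -scalemxAr -scalemxAl.
    by rewrite linear_part_related_nilpotent.
  rewrite /w -scalemxAl scalerA -expRD subrr expR0 scale1r.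
  rewrite -mulmxA; congr (_ *m _).
  rewrite mulmxA (_ : _ *m (1%:M + _) = 1%:M) ?mul1mx//.
  rewrite mulmxDr mulmx1 mulmxBl mul1mx -scalemxAl -scalemxAr.
  by rewrite transvection_part_sqr// !scaler0 subr0 subrK.
by rewrite [in LHS]Gz [in LHS]Lz -scalerBr -mulmxBl.
Qed.

(** If [q], the norm of [G z - z L], were positive, then [flow_conjugation] and
    [remainder_quadratic] would bound it by a constant times
    [(1 + t)^3 e^(-t)], hence by [M / (1 + t)], as soon as the point [w] is
    within [d] of the origin. *)
Lemma related_map_linear z : G z = z *m L.
Proof.
have [K K0 [d d0 HK]] := remainder_quadratic.
pose A := n%:R * `|z| * (`|1%:M : 'M[R]_n| + `|N a|).
pose B := n%:R * (`|1%:M : 'M[R]_n| + `|N b|).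
have A0 : 0 <= A by rewrite !mulr_ge0// addr_ge0.
have B0 : 0 <= B by rewrite !mulr_ge0// addr_ge0.
pose M := 256 * (K * A ^+ 2 * B).
have M0 : 0 <= M by rewrite !mulr_ge0// exprn_ge0.
apply/eqP; rewrite -subr_eq0 -normr_eq0; apply/negPn/negP => q_neq0.
set q := `|_| in q_neq0; have q0 : 0 < q by rewrite lt_neqAle eq_sym q_neq0 normr_ge0.
(* The first summand contradicts [q * p <= M]; the second puts [w] within [d]. *)
pose t := M / q + 256 * A / d; pose p := 1 + t.
have t0 : 0 <= t by rewrite addr_ge0// ?divr_ge0 ?mulr_ge0// ltW.
have p1 : 1 <= p by rewrite lerDl.
have p0 : 0 < p by rewrite (lt_le_trans ltr01).
have affine_le (X Y : 'M[R]_n) : `|X + t *: Y| <= (`|X| + `|Y|) * p.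
  rewrite (le_trans (ler_normD _ _))// normrZ ger0_norm//.
  have xt0 := mulr_ge0 t0 (normr_ge0 X); have y0 := normr_ge0 Y.
  by move: xt0 y0; rewrite /p; move: `|X| `|Y| => x y; clear; lra.
have eps_p4 : p ^+ 4 * expR (- t) <= 256 := pow4_expRN_le t0.
set eps := expR (- t) in eps_p4.
have eps0 : 0 < eps := expR_gt0 _.
have := flow_conjugation z t; rewrite -/eps /=; set w := eps *: _.
have w_le : `|w| <= A * (p * eps).
  rewrite normrZ gtr0_norm// mulrA mulrC ler_wpM2r ?(ltW eps0)//.
  rewrite (le_trans (normr_mulmx _ _))// /A -[leRHS]mulrA ler_wpM2l ?mulr_ge0//.
  by have := affine_le 1%:M (- N a); rewrite scalerN normrN.
have w_small : `|w| < d.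
  have : p * (A * (p * eps)) <= 256 * A.
    have -> : p * (A * (p * eps)) = A * (p ^+ 2 * eps) by ring.
    rewrite mulrC ler_wpM2r// (le_trans _ eps_p4)// ler_wpM2r ?(ltW eps0)//.
    exact: ler_weXn2l.
  move=> pw; rewrite (le_lt_trans w_le)// -(ltr_pM2l p0) (le_lt_trans pw)//.
  rewrite -ltr_pdivrMr// /p /t addrA ltrDr ltr_wpDr// ?divr_ge0// ltW//.
move=> /(congr1 Num.norm); rewrite -/q normrZ gtr0_norm ?expR_gt0// => qE.
have q_le : q <= K * A ^+ 2 * B * (p ^+ 3 * eps).
  have epsV : expR t = eps^-1 by rewrite /eps expRN invrK.
  rewrite qE epsV ler_pdivrMl//.
  rewrite (le_trans (normr_mulmx _ _))//.
  have -> : eps * (K * A ^+ 2 * B * (p ^+ 3 * eps)) =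
    n%:R * (K * (A * (p * eps)) ^+ 2) * ((`|1%:M : 'M[R]_n| + `|N b|) * p).
    by rewrite /B; ring.
  apply: ler_pM => //.
  rewrite ler_wpM2l// (le_trans (HK _ w_small))// ler_wpM2l//.
  by rewrite lerXn2r ?nnegrE// (le_trans _ w_le).
have : q * p <= M.
  rewrite (le_trans (ler_wpM2r (ltW p0) q_le))// /M [256 * _]mulrC.
  have -> : K * A ^+ 2 * B * (p ^+ 3 * eps) * p =
    K * A ^+ 2 * B * (p ^+ 4 * eps) by ring.
  by rewrite ler_wpM2l ?mulr_ge0 ?exprn_ge0.
apply/negP; rewrite -ltNge /p /t addrA mulrDr mulrDr mulr1.
rewrite mulrCA divff ?gt_eqF// mulr1.
by rewrite ltr_wpDr ?ltrDr// !mulr_ge0// ?invr_ge0 ltW.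
Qed.

(** Cancelling [L S] in [L N_b = N_a L] leaves the rank one identity
    [b^T b = c^T c] with [c = a L], which determines [b] up to sign. *)
Lemma related_map_parameter : a *m L = b \/ a *m L = - b.
Proof.
set c := a *m L.
have Lsymp := jacobian_symplectic 0.
have cc : b^T *m b = c^T *m c.
  have E := linear_part_related_nilpotent.
  rewrite /N !trmx_mul S_skew !mulNmx mulmxN in E; move/oppr_inj in E.
  have L_unit := jacobian_unit 0.
  apply: (can_inj (mulKmx S_unit)); apply: (can_inj (mulKmx L_unit)).
  rewrite [S *m (b^T *m b)]mulmxA E -{1}Lsymp /c trmx_mul.
  by rewrite !mulmxA.
have ccE i j : b 0 i * b 0 j = c 0 i * c 0 j.
  by have /matrixP/(_ i j) := cc; rewrite !mxE !big_ord1 !mxE.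
have [c0|] := eqVneq c 0.
  left; rewrite c0; apply/rowP => i; have /eqP := ccE i i.
  by rewrite c0 !mxE mulr0 mulf_eq0 orbb => /eqP.
(* A nonzero coordinate of [c] fixes the sign, and then all coordinates. *)
move=> /rV0Pn[i ci].
have /eqP : b 0 i ^+ 2 = c 0 i ^+ 2 by rewrite !expr2.
rewrite eqf_sqr => /orP[] /eqP bi; [left|right]; apply/rowP => j;
  apply: (mulfI ci); have := ccE i j; rewrite bi ?mxE; lra.
Qed.

End Rigidity.

(** * From coordinates to the symplectic vector space *)

Section Coordinates.
Context {R : realType} {V : vectType R}.
Variable Omega : {biscalar V}.

Definition form_matrix : 'M[R]_(dim V) :=
  \matrix_(i, j) Omega (r2v (delta_mx 0 i)) (r2v (delta_mx 0 j)).

Local Notation S := form_matrix.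
Local Notation P := (transvection S).

Lemma form_matrixE x y : Omega x y = (v2r x *m S *m (v2r y)^T) 0 0.
Proof.
rewrite -[x in LHS]v2rK -[y in LHS]v2rK; move: (v2r x) (v2r y) => u v.
rewrite {1}(row_sum_delta v) linear_sum linear_sumr mxE.
apply: eq_bigr => j _ /=; rewrite [r2v (_ *: _)]linearZ linearZr_LR /=.
rewrite [v^T _ _]mxE mulrC.
congr (_ * _); rewrite {1}(row_sum_delta u) linear_sum linear_sumlz mxE.
by apply: eq_bigr => i _ /=; rewrite [r2v (_ *: _)]linearZ linearZl_LR /= mxE.
Qed.

Lemma theta_E a z v : theta_ Omega a z v =
  2^-1 * (Omega z v + Omega a z * Omega a v).
Proof.
rewrite /theta_ /liouville /ext_d /tangent mulrDr; congr (_ + _).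
rewrite derive1E /psi_.
pose x := Omega a z; pose y := Omega a v.
have -> : (fun t : R => 4^-1 * Omega a (z + t *: v) ^+ 2) =
    4^-1 *: ((cst x + y *: id) ^+ 2).
  apply/funext => t.
  have -> : Omega a (z + t *: v) = x + y * t.
    by rewrite linearDr linearZr_LR /= mulrC.
  by rewrite !fctE.
rewrite derive_val.
have -> : (cst x + y *: id : R -> R) 0 = x by rewrite !fctE /= scaler0 addr0.
rewrite -/x -/y add0r expr1 /GRing.scale/= mulr1.
by field.
Qed.

(** The form [theta^a] is half the contraction of the symplectic form with the
    vector field [z |-> z P_a]. *)
Lemma theta_matrixE a z v : theta_ Omega a z v =
  2^-1 * (v2r z *m (P (v2r a) *m S) *m (v2r v)^T) 0 0.
Proof.
rewrite theta_E !form_matrixE /transvection /transvection_part.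
move: (v2r a) (v2r z) (v2r v) => {}a {}z {}v; congr (_ * _).
rewrite mulmxDl mul1mx mulmxDr mulmxDl [RHS]mxE; congr (_ + _).
have -> : z *m ((a *m S)^T *m a *m S) *m v^T =
    (z *m (a *m S)^T) *m (a *m S *m v^T) by rewrite !mulmxA.
rewrite [RHS]mxE big_ord1; congr (_ * _).
by rewrite -[z in RHS]trmxK -trmx_mul [RHS]mxE.
Qed.

Hypothesis Omega_alt : alternating_form Omega.

Lemma alternating_formC x y : Omega x y = - Omega y x.
Proof.
have := Omega_alt (x + y); rewrite linearDl !linearDr /= !Omega_alt.
rewrite add0r addr0 => /eqP; by rewrite addr_eq0 => /eqP.
Qed.

Lemma form_matrix_skew : S^T = - S.
Proof. by apply/matrixP => i j; rewrite !mxE alternating_formC. Qed.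

Lemma form_matrix_unit : nonsingular_form Omega -> S \in unitmx.
Proof.
move=> Omega_ns; rewrite -row_free_unit; apply: inj_row_free => u uS.
apply: (can_inj (@r2vK _ V)); rewrite linear0; apply: Omega_ns => y.
by rewrite form_matrixE r2vK uS mul0mx mxE.
Qed.

End Coordinates.

(** A linear map in coordinates is right multiplication by a matrix, so it is
    continuous and its own differential. *)
Lemma smooth_linear (R : realType) (V W : vectType R) (g : V -> W) :
  linear g -> smooth g /\ forall z v, tangent_map g z v = g v.
Proof.
move=> g_lin.
have gc_lin : linear (in_coords g).
  by move=> k x y; rewrite /in_coords linearP g_lin linearP.
pose f : {linear 'rV[R]_(dim V) -> 'rV[R]_(dim W)} :=
  HB.pack (in_coords g) (GRing.isLinear.Build _ _ _ _ _ gc_lin).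
have f_cont : continuous f.
  have -> : f = mulmxr (lin1_mx f) :> (_ -> _).
    by apply/funext => x; exact/esym/(mul_rV_lin1 f).
  exact: mulmxr_continuous.
have f_diff x : differentiable f x by exact: linear_differentiable.
have d_lin x : 'd f x = f :> (_ -> _) by exact: diff_lin.
split=> [k|z v]; last first.
  by rewrite /tangent_map -/(f : _ -> _) d_lin /= /in_coords !v2rK.
have cstC : forall k (c : 'rV[R]_(dim W)), class_C k (cst c : 'rV[R]_(dim V) -> _).
  elim=> [|j IH] c; first by move=> x; exact: cst_continuous.
  split=> [x|v]; first exact: differentiable_cst.
  have -> : (fun x : 'rV[R]_(dim V) => 'D_v (cst c) x) = cst 0.
    by apply/funext => x; rewrite derive_cst.
  exact: IH.
case: k => [|k]; first exact: f_cont.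
split=> [x|v]; first exact: (f_diff x).
have -> : (fun x => 'D_v (in_coords g) x) = cst (f v).
  apply/funext => x; rewrite deriveE; last exact: (f_diff x).
  by rewrite [LHS](congr1 (fun h => h v) (d_lin x)).
exact: cstC.
Qed.

Section Main.
Context {R : realType} {V : vectType R}.
Variable Omega : {biscalar V}.
Hypothesis Omega_alt : alternating_form Omega.
Hypothesis Omega_ns : nonsingular_form Omega.
Local Notation S := (form_matrix Omega).

Lemma Sp_sub_Iso a b gamma :
  Sp Omega gamma -> gamma a = b \/ gamma a = - b -> Iso Omega a b gamma.
Proof.
move=> [g_lin _ g_Omega] gab; have [g_smooth g_tangent] := smooth_linear g_lin.
split=> //; apply/funext => z; apply/funext => v.
rewrite /pullback g_tangent !theta_E g_Omega; congr (_ * (_ + _)).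
rewrite -(g_Omega a z) -(g_Omega a v).
case: gab => -> //.
have N x : Omega (- b) x = - Omega b x by exact: linearNl.
by rewrite !N mulrNN.
Qed.

Lemma Iso_sub_Sp a b g :
  Iso Omega a b g -> Sp Omega g /\ (g a = b \/ g a = - b).
Proof.
move=> [g_smooth g_pullback].
pose G := in_coords g; have G2 : class_C 2 G := g_smooth 2%N.
have S_skew := form_matrix_skew Omega_alt.
have S_unit := form_matrix_unit Omega_ns.
have pullbackG z : G z *m (transvection S (v2r b) *m S) *m (jacobian G z)^T
    = z *m (transvection S (v2r a) *m S).
  apply/rowP => i.
  have := congr1 (fun eta => eta (r2v z) (r2v (delta_mx 0 i))) g_pullback.
  rewrite /pullback !theta_matrixE /tangent_map !r2vK.
  have [G1 _] := G2.
  have -> : 'd (in_coords g) z (delta_mx 0 i) = delta_mx 0 i *m jacobian G z.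
    by rewrite -deriveEjacobian ?deriveE//; exact: G1.
  have half_neq0 : 2^-1 != 0 :> R by rewrite invr_eq0 pnatr_eq0.
  move=> /(mulfI half_neq0); rewrite trmx_mul [_ *m (_^T *m _^T)]mulmxA.
  have entryE (u : 'rV[R]_(dim V)) : (u *m (delta_mx 0 i)^T) 0 0 = u 0 i.
    rewrite mxE (bigD1 i)//= !mxE !eqxx mulr1 big1 ?addr0// => j j_neq_i.
    by rewrite !mxE (negPf j_neq_i) andbF mulr0.
  by rewrite !entryE; exact.
have g_E x : g x = r2v (v2r x *m jacobian G 0).
  by rewrite -(related_map_linear S_skew S_unit G2 pullbackG) /G /in_coords !v2rK.
have L_unit := jacobian_unit S_skew S_unit G2 pullbackG 0.
split; last first.
  have := related_map_parameter S_skew S_unit G2 pullbackG.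
  by rewrite g_E => -[] ->; [left; rewrite v2rK|right; rewrite linearN /= v2rK].
split.
- by move=> k x y; rewrite !g_E linearP mulmxDl -scalemxAl linearP.
- exists (fun x => r2v (v2r x *m invmx (jacobian G 0))) => x.
    by rewrite g_E r2vK mulmxK// v2rK.
  by rewrite g_E r2vK mulmxKV// v2rK.
- move=> x y; rewrite !form_matrixE !g_E !r2vK trmx_mul.
  by rewrite -[in RHS](jacobian_symplectic S_skew G2 pullbackG 0) !mulmxA.
Qed.

End Main.

Theorem mainTheorem8 (R : realType) (V : vectType R) (Omega : {biscalar V})
    (Omega_alt : alternating_form Omega) (Omega_ns : nonsingular_form Omega) (a b : V) :
  Iso Omega a b = [set gamma | Sp Omega gamma /\ (gamma a = b \/ gamma a = - b)].
Proof.
apply/seteqP; split => g /=; first exact: Iso_sub_Sp.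
by move=> [g_Sp g_ab]; exact: Sp_sub_Iso.
Qed.
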